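(* Let $n\ge 2$ be an integer, let $\delta\in(0,\infty)$ be an unknown parameter, and let $X_1,X_2,\ldots$ be i.i.d. exponential random variables with density $f(x;\delta)=\frac1\delta e^{-x/\delta}$, $x\ge 0$. Let $X_{T(1)}$ and $X_{T(n)}$ be the first and $n$-th upper record values of the sequence and let $R_n=X_{T(n)}-X_{T(1)}$ be the upper record range. Consider estimation of $\delta$ on the basis of the observation $R_n$ under the quadratic loss $$L(\hat\delta,\delta)=\frac{1}{\delta^2}(\hat\delta-\delta)^2 .$$ Then the estimator $m\,(X_{T(n)}-X_{T(1)})+d=mR_n+d$ is admissible in each of the following cases: 1. $m\in[0,1/n)$ and $d>0$; 2. $m=1/n$ and $d>0$.
   Context: Upper record times and values: $T(1)=1$ and $T(k+1)=\min\{j>T(k): X_j\ge X_{T(k)}\}$ for $k\ge1$; the upper record values are $X_{T(1)},X_{T(2)},\ldots$. For the exponential distribution with scale $\delta$, the upper record range $R_n=X_{T(n)}-X_{T(1)}$ has density $$f_{R_n}(r)=\frac{r^{n-2}e^{-r/\delta}}{(n-2)!\,\delta^{n-1}},\qquad r>0,$$ i.e. $R_n$ has the Gamma distribution with shape $n-1$ and scale $\delta$. An estimator based on $R_n$ is a (Borel measurable, real-valued) function $\hat\delta=\hat\delta(R_n)$; its risk at $\delta$ is $\mathrm{Risk}(\hat\delta,\delta)=E_\delta[L(\hat\delta(R_n),\delta)]\in[0,\infty]$. An estimator $\hat\delta$ based on $R_n$ is admissible if there is no estimator $\hat\delta'$ based on $R_n$ with $\mathrm{Risk}(\hat\delta',\delta)\le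 \mathrm{Risk}(\hat\delta,\delta)$ for all $\delta\in(0,\infty)$ and with strict inequality for at least one $\delta\in(0,\infty)$. *)

(* Defs.v *)
From HB Require Import structures.
From mathcomp Require Import all_boot all_order all_algebra.
From mathcomp Require Import all_classical all_reals all_analysis.

Set Implicit Arguments.
Unset Strict Implicit.
Unset Printing Implicit Defensive.

Import Order.TTheory GRing.Theory Num.Theory.
Import numFieldNormedType.Exports.

Local Open Scope classical_set_scope.
Local Open Scope ring_scope.

(* Sequences are indexed from 0: x i stands for the observation usually written
   x_(i+1), and record_time x k for T(k+1) - 1. *)

(* The first j > i with x j >= x i (ties count as records). If there is none,
   the value is i itself; for i.i.d. exponential observations this happens with
   probability 0, so the convention has no effect on the risk. *)
Definition next_record (R : realType) (x : nat -> R) (i : nat) : nat :=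
  if pselect (exists j, (i < j)%N && (x i <= x j)) is left ex_j
  then ex_minn ex_j else i.

Fixpoint record_time (R : realType) (x : nat -> R) (k : nat) : nat :=
  if k is k'.+1 then next_record x (record_time x k') else 0%N.

Definition record_value (R : realType) (x : nat -> R) (k : nat) : R :=
  x (record_time x k).

(* X_T(n) - X_T(1), for n >= 1 *)
Definition record_range (R : realType) (x : nat -> R) (n : nat) : R :=
  record_value x n.-1 - record_value x 0.

Definition mutually_independent d (Omega : measurableType d) (R : realType)
    (P : probability Omega R) (X : nat -> {mfun Omega >-> R}) : Prop :=
  forall (s : seq nat) (A : nat -> set R),
    uniq s -> (forall i, measurable (A i)) ->
    P [set w | forall i, i \in s -> A i (X i w)] =
    (\prod_(i <- s) P (X i @^-1` A i))%E.

(* delta is the scale (mean), whereas exponential_prob takes the rate. *)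
Definition iid_exponential d (Omega : measurableType d) (R : realType)
    (P : probability Omega R) (X : nat -> {mfun Omega >-> R}) (delta : R) :
    Prop :=
  mutually_independent P X /\
  forall i (A : set R), measurable A ->
    distribution P (X i) A = exponential_prob delta^-1 A.

Definition quadratic_loss (R : realType) (a delta : R) : R :=
  (delta ^+ 2)^-1 * (a - delta) ^+ 2.

(* The loss is nonnegative, so this expectation is its value in [0, +oo]. *)
Definition risk d (Omega : measurableType d) (R : realType)
    (P : R -> probability Omega R) (Y : Omega -> R) (est : R -> R)
    (delta : R) : \bar R :=
  'E_(P delta)[fun w => quadratic_loss (est (Y w)) delta]%E.

(* Admissibility of est(Y) among the estimators based on Y, for the parameter
   space (0, +oo). *)
Definition admissible d (Omega : measurableType d) (R : realType)
    (P : R -> probability Omega R) (Y : Omega -> R) (est : R -> R) : Prop :=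
  measurable_fun [set: R] est /\
  ~ exists est' : R -> R,
      [/\ measurable_fun [set: R] est',
          forall delta, 0 < delta -> (risk P Y est' delta <= risk P Y est delta)%E
        & exists2 delta, 0 < delta &
            (risk P Y est' delta < risk P Y est delta)%E].

(* Main.v *)
(* Write t = 1 / delta and R = R_n. By lack of memory the record values form a
   random walk with exponential steps, so the laws of R form an exponential
   family: at rate t, R has density t^(n-1) e^(-(t-1) R) with respect to its law
   at rate 1. This is all that is needed about the Gamma distribution.

   Suppose that m R + d + h(R) does at least as well as m R + d for every t.
   Let J(t) and Q(t) be the integrals of h e^(-(t-1) R) and h^2 e^(-(t-1) R) at
   rate 1. Comparing the risks gives t Q <= 2 ((1 - d t) J + m t J'). If m = 0,
   take t = 1 / d to get Q(t) <= 0. If m > 0, then H = t^(1/m) e^(-d t/m) J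
   satisfies H' >= t^(1/m) e^(-d t/m) Q / (2 m) >= 0, and H tends to 0 at
   infinity, so H <= 0. By Cauchy-Schwarz J^2 <= Q t^(-(n-1)), so 1/m >= n gives
   the Riccati inequality H' >= H^2 / (2 m t) on (0, 1]; since 1/t is not
   integrable at 0, H cannot be negative. Hence H = 0, and Q vanishes somewhere,
   which forces h(R) = 0 almost surely. *)

Require Import Defs.
From HB Require Import structures.
From mathcomp Require Import all_boot all_order all_algebra.
From mathcomp Require Import all_classical all_reals all_analysis.
From mathcomp Require Import measurable_realfun zify ring lra.

Set Implicit Arguments.
Unset Strict Implicit.
Unset Printing Implicit Defensive.

Import Order.TTheory GRing.Theory Num.Theory.
Import numFieldNormedType.Exports.

Local Open Scope classical_set_scope.
Local Open Scope ring_scope.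

(** * Exponential distribution *)

Section density.
Context (d : measure_display) (T : measurableType d) (R : realType).
Variables mu m : {measure set T -> \bar R}.
Variable p : T -> R.
Hypothesis p_ge0 : forall x, 0 <= p x.
Hypothesis measurable_p : measurable_fun [set: T] p.
Hypothesis mE : forall A, measurable A -> m A = (\int[mu]_(x in A) (p x)%:E)%E.

Import HBNNSimple.

(** The formula holds for indicators by [mE], hence for simple functions by linearity, and monotone
    convergence along [nnsfun_approx] extends it to every nonnegative measurable [f]. *)
Lemma ge0_integral_density (f : T -> \bar R) :
  measurable_fun [set: T] f -> (forall x, 0 <= f x)%E ->
  (\int[m]_x f x = \int[mu]_x (f x * (p x)%:E))%E.
Proof.
move=> mf f0; pose f_ := nnsfun_approx measurableT mf.
have cvf x : (f_ n x)%:E @[n --> \oo] --> f x.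
  by apply: cvg_nnsfun_approx => // y _; exact: f0.
have ndf x : {homo (fun n => (f_ n x)%:E) : a b / (a <= b)%N >-> (a <= b)%E}.
  by move=> a b ab; rewrite lee_fin; exact/lefP/nd_nnsfun_approx.
have mf_ n : measurable_fun [set: T] (fun x => (f_ n x)%:E).
  by apply/measurable_EFinP; exact: measurable_funP.
have mp : measurable_fun [set: T] (fun x => (p x)%:E) by exact/measurable_EFinP.
transitivity (limn (fun n => \int[m]_x (f_ n x)%:E)%E).
  rewrite -monotone_convergence//.
  - by apply: eq_integral => x _; apply/esym/cvg_lim => //; exact: cvf.
  - by move=> n x _; rewrite lee_fin.
rewrite (_ : (fun _ => _) = (fun n => \int[mu]_x ((f_ n x)%:E * (p x)%:E))%E).
  rewrite -monotone_convergence//.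
  - apply: eq_integral => x _; apply/cvg_lim => //.
    by apply: cvgeZr => //; exact: cvf.
  - by move=> n; exact: emeasurable_funM.
  - by move=> n x _; rewrite mule_ge0// lee_fin.
  - move=> x _ a b ab; rewrite lee_wpmul2r ?lee_fin//.
    by have := ndf x _ _ ab; rewrite lee_fin.
apply/funext => n.
have mp_ r : measurable_fun [set: T]
    (fun x => (r * \1_(f_ n @^-1` [set r]) x)%:E * (p x)%:E)%E.
  by apply: emeasurable_funM => //; exact/measurable_EFinP/measurable_funM.
transitivity (\int[mu]_x (\sum_(r \in range (f_ n))
    ((r * \1_(f_ n @^-1` [set r]) x)%:E * (p x)%:E)))%E; last first.
  apply: eq_integral => x _; rewrite -ge0_mule_fsuml => [|r]; last first.
    exact: nnfun_muleindic_ge0.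
  by rewrite fsumEFin// -fimfunE.
under eq_integral do rewrite fimfunE -fsumEFin//.
rewrite !ge0_integral_fsum//.
- apply: eq_fsbigr => r; rewrite inE => -[t _ tr].
  under [RHS]eq_integral do rewrite EFinM -muleA.
  rewrite ge0_integralZl//; last 3 first.
  + apply: emeasurable_funM => //; exact/measurable_EFinP.
  + by move=> x _; rewrite mule_ge0// lee_fin.
  + by rewrite -tr lee_fin.
  rewrite integralZl_indic_nnsfun// integral_indic// setIT mE//; congr (_ * _)%E.
  rewrite [LHS]integral_mkcond; apply: eq_integral => x _.
  by rewrite epatch_indic muleC.
- by move=> r x _; rewrite mule_ge0 ?lee_fin// -lee_fin nnfun_muleindic_ge0.
- by move=> r; exact/measurable_EFinP/measurable_funM.
- by move=> r x _; rewrite nnfun_muleindic_ge0.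
Qed.

End density.

(** * Lack of memory of the exponential law *)

Section exponential.
Context (R : realType).
Variable r : R.
Hypothesis r_gt0 : 0 < r.
Local Notation nu := (exponential_prob r).

Lemma ge0_integral_exponential (f : R -> \bar R) :
  measurable_fun [set: R] f -> (forall x, 0 <= f x)%E ->
  (\int[nu]_x f x =
   \int[lebesgue_measure]_x (f x * (exponential_pdf r x)%:E))%E.
Proof.
move=> mf f0; apply: ge0_integral_density => //.
- by move=> x; exact/exponential_pdf_ge0/ltW.
- exact: measurable_exponential_pdf.
Qed.

(** The image of Lebesgue measure under translation is Lebesgue measure: by uniqueness it suffices
    to compare lengths of half-open intervals. *)
Lemma ge0_integral_lebesgue_shift (a : R) (f : R -> \bar R) :
  measurable_fun [set: R] f -> (forall x, 0 <= f x)%E ->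
  (\int[lebesgue_measure]_x f x = \int[lebesgue_measure]_x f (a + x)%R)%E.
Proof.
move=> mf f0.
have ma : measurable_fun [set: measurableTypeR R] (+%R a : R -> measurableTypeR R).
  exact: measurable_funD.
rewrite -(@ge0_integral_pushforward _ _ _ _ _ _ ma _ setT)//.
apply: eq_measure_integral => A mA _; apply: lebesgue_measure_unique => //.
move=> _ [[b c]] _ <- /=; rewrite /pushforward.
rewrite (_ : _ @^-1` _ = `](b - a), (c - a)]%classic); last first.
  by apply/seteqP; split => x /=; rewrite !in_itv/= ltrBlDl lerBrDl.
rewrite !lebesgue_measure_itv/= !lte_fin ltrD2r.
by case: ifPn => // _; rewrite -!EFinB; congr (_%:E); ring.
Qed.

(** Lack of memory in integrated form. The shift by [x] carries [[x, +oo[] to [[0, +oo[], where the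
    density at [x + y] is [expR (- r * x)] times the density at [y]. *)
Lemma exponential_memoryless (x : R) (f : R -> \bar R) : 0 <= x ->
  measurable_fun [set: R] f -> (forall y, 0 <= f y)%E ->
  (\int[nu]_(y in `[x, +oo[) f y =
   (expR (- r * x))%:E * \int[nu]_y f (x + y)%R)%E.
Proof.
move=> x0 mf f0.
have mfx : measurable_fun [set: R] (fun y => f (x + y)).
  by apply: (measurableT_comp mf); exact: measurable_funD.
have mfxp : measurable_fun [set: R]
    (fun y => f (x + y)%R * (exponential_pdf r y)%:E)%E.
  apply: emeasurable_funM => //.
  by apply/measurable_EFinP; exact: measurable_exponential_pdf.
rewrite integral_mkcond [LHS]ge0_integral_exponential//; last 2 first.
- by apply/(measurable_restrictT _ _).1 => //; exact: measurable_funTS.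
- by move=> y; rewrite patchE; case: ifP.
rewrite [LHS](@ge0_integral_lebesgue_shift x); last 2 first.
- apply: emeasurable_funM.
    by apply/(measurable_restrictT _ _).1 => //; exact: measurable_funTS.
  by apply/measurable_EFinP; exact: measurable_exponential_pdf.
- move=> y; rewrite mule_ge0//; first by rewrite patchE; case: ifP.
  by rewrite lee_fin exponential_pdf_ge0// ltW.
rewrite ge0_integral_exponential// -ge0_integralZl//=; last first.
- by move=> y _; rewrite mule_ge0// lee_fin exponential_pdf_ge0// ltW.
apply: eq_integral => y _; rewrite patchE.
case: ifPn => [|/negP]; rewrite inE/= in_itv/= andbT lerDl.
  move=> y0; rewrite !exponential_pdfE ?addr_ge0// muleCA -EFinM; congr (_ * _%:E)%E.
  by rewrite mulrDr expRD; ring.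
move=> /negP; rewrite -ltNge => y0.
by rewrite mul0e (lt0_exponential_pdf _ y0) mule0 mule0.
Qed.

Lemma exponential_prob_itvcy (x : R) : 0 <= x ->
  nu `[x, +oo[ = (expR (- r * x))%:E.
Proof.
move=> x0; have := @exponential_memoryless x (cst 1%E) x0.
rewrite integral_cst// mul1e => ->//.
have -> : (fun y : R => cst (1%E : \bar R) (x + y)%R) = cst 1%E by [].
by rewrite integral_cst//= /exponential_prob integral_exponential_pdf// !mule1.
Qed.

Lemma exponential_prob_lt0 : nu [set x | x < 0] = 0%E.
Proof.
rewrite /exponential_prob integral0_eq// => x /= x0.
by rewrite lt0_exponential_pdf.
Qed.

End exponential.

(** The ratio of the densities at rates [r] and 1 is $r e^{-(r-1)y}$. This is the change of rate for
    a single step of the random walk of records. *)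
Lemma exponential_tilt (R : realType) (r : R) (f : R -> \bar R) : 0 < r ->
  measurable_fun [set: R] f -> (forall x, 0 <= f x)%E ->
  (\int[exponential_prob r]_y f y =
   r%:E * \int[exponential_prob 1]_y (f y * (expR (- (r - 1) * y))%:E))%E.
Proof.
move=> r0 mf f0.
have me : measurable_fun [set: R] (fun y => (expR (- (r - 1) * y))%:E).
  by apply/measurable_EFinP; apply: measurableT_comp => //; exact: measurable_funM.
have mfep : measurable_fun [set: R] (fun y => f y * (expR (- (r - 1) * y))%:E *
    (exponential_pdf 1 y)%:E)%E.
  apply: emeasurable_funM; first exact: emeasurable_funM.
  by apply/measurable_EFinP; exact: measurable_exponential_pdf.
rewrite !ge0_integral_exponential//; last 2 first.
- exact: emeasurable_funM.
- by move=> y; rewrite mule_ge0// lee_fin expR_ge0.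
rewrite -ge0_integralZl//; last 2 first.
- move=> y _; rewrite !mule_ge0 ?lee_fin ?expR_ge0//.
  exact: exponential_pdf_ge0.
- exact: ltW.
apply: eq_integral => y _; rewrite -muleA [RHS]muleCA -!EFinM; congr (_ * _%:E)%E.
have [y0|y0] := leP 0 y; last by rewrite !lt0_exponential_pdf// !mulr0.
rewrite !exponential_pdfE// mul1r -expRD; congr (_ * expR _); ring.
Qed.

(** * The past of an independent sequence *)

Section past.
Context (disp : measure_display) (Omega : measurableType disp) (R : realType).
Variables (X : nat -> {mfun Omega >-> R}).

(** A pi-system of cylinders generating the sigma-algebra of [X 0], ..., [X s.-1]; the coordinate
    [X s] is excluded. *)
Definition past (s : nat) : set (set Omega) :=
  [set A | exists2 B : nat -> set R, (forall i, measurable (B i)) &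
     A = [set w | forall i, (i < s)%N -> B i (X i w)]].

Lemma past_measurable s : past s `<=` measurable.
Proof.
move=> _ [B mB ->].
rewrite (_ : [set _ | _] = \bigcap_(i in `I_s) (X i @^-1` B i)); last first.
  by apply/seteqP; split.
apply: bigcap_measurableType => i _.
by rewrite -[X in measurable X]setTI; exact: measurable_funP.
Qed.

Lemma pastT s : past s setT.
Proof. by exists (fun=> setT) => //; apply/seteqP; split. Qed.

Lemma past_setI s : setI_closed (past s).
Proof.
move=> _ _ [B mB ->] [C mC ->]; exists (fun i => B i `&` C i).
  by move=> i; exact: measurableI.
apply/seteqP; split => [w [Bw Cw] i si|w BCw]; first by split; auto.
by split => i si; case: (BCw i si).
Qed.

Lemma past_sub s t : (s <= t)%N -> past s `<=` past t.
Proof.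
move=> st _ [B mB ->]; exists (fun i => if (i < s)%N then B i else setT).
  by move=> i; case: ifP.
apply/seteqP; split => w Bw i; first by move=> _; case: ifPn => // /Bw.
by move=> si; have := Bw i (leq_trans si st); rewrite si.
Qed.

Notation past_type s := (g_sigma_algebraType (past s)).

Lemma past_sigma_sub s : <<s past s >> `<=` measurable.
Proof. exact: smallest_sub (@sigma_algebra_measurable _ Omega) (@past_measurable s). Qed.

(** The identity into the coarser measurable space; its distribution is the restriction of [P] to
    the past. *)
Definition to_past s (w : Omega) : past_type s := w.

Lemma measurable_to_past s : measurable_fun [set: Omega] (to_past s).
Proof. by move=> _ A mA; rewrite setTI; exact: past_sigma_sub mA. Qed.

HB.instance Definition _ s := isMeasurableFun.Build _ _ _ _
  (to_past s) (@measurable_to_past s).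

Lemma measurable_past_fun d' (U : measurableType d') s t (f : Omega -> U) :
  (s <= t)%N -> measurable_fun [set: past_type s] f ->
  measurable_fun [set: past_type t] f.
Proof.
move=> st mf _ A mA; have /= := mf measurableT _ mA.
by move/(@sub_sigma_algebra2 _ setT _ _ (@past_sub _ _ st)).
Qed.

Lemma measurable_past d' (U : measurableType d') s (f : Omega -> U) :
  measurable_fun [set: past_type s] f -> measurable_fun [set: Omega] f.
Proof.
move=> mf _ A mA; exact: past_sigma_sub (mf measurableT _ mA).
Qed.

Lemma measurable_past_X s i : (i < s)%N ->
  measurable_fun [set: past_type s] (X i).
Proof.
move=> si _ A mA; apply: sub_sigma_algebra; rewrite setTI.
exists (fun j => if j == i then A else setT); first by move=> j; case: ifP.
apply/seteqP; split => w /=; first by move=> Aw j _; case: ifPn => // /eqP ->.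
by move=> /(_ i si); rewrite eqxx.
Qed.

Variables (P : probability Omega R) (nu : probability R R).
Hypothesis X_indep : mutually_independent P X.
Hypothesis X_law : forall i A, measurable A -> P (X i @^-1` A) = nu A.

(** The product formulas for the indices below [s] and for those up to [s] differ exactly by the
    factor of [X s]. *)
Lemma past_indep0 s A B : past s A -> measurable B ->
  P (A `&` X s @^-1` B) = (P A * nu B)%E.
Proof.
move=> [C mC ->] mB.
pose D i := if i == s then B else C i.
have mD i : measurable (D i) by rewrite /D; case: ifP.
have DsE : D s = B by rewrite /D eqxx.
have := @X_indep (iota 0 s.+1) D (iota_uniq _ _) mD.
have := @X_indep (iota 0 s) C (iota_uniq _ _) mC.
rewrite -addn1 iotaD big_cat/= big_seq1 add0n DsE X_law//.
rewrite [X in (_ = X * _)%E -> _](_ : _ = \prod_(i <- iota 0 s) P (X i @^-1` C i))%E.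
  move=> PC PD; rewrite (_ : _ `&` _ =
      [set w | forall i, i \in iota 0 s ++ [:: s] -> D i (X i w)]).
    rewrite PD -PC; congr (P _ * _)%E.
    by apply/seteqP; split => w /= h i; move: (h i); rewrite mem_iota add0n.
  apply/seteqP; split => w /=.
    move=> [Cw Bw] i; rewrite mem_cat mem_iota add0n inE /D.
    by case: eqP => [-> //|_]; rewrite orbF => /Cw.
  move=> Dw; split.
    move=> i si; have := Dw i; rewrite mem_cat mem_iota/= add0n si /D.
    by rewrite ltn_eqF//; apply.
  by have := Dw s; rewrite mem_cat inE eqxx orbT /D eqxx; apply.
rewrite big_seq [RHS]big_seq; apply: eq_bigr => i; rewrite mem_iota add0n => /= si.
by rewrite /D ltn_eqF.
Qed.

(** For fixed [B] both sides are finite measures in [A]; they agree on the pi-system [past s], hence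
    on the sigma-algebra it generates. *)
Lemma past_indep s A B : <<s past s >> A -> measurable B ->
  P (A `&` X s @^-1` B) = (P A * nu B)%E.
Proof.
move=> pA mB.
have mXB : measurable (X s @^-1` B).
  by rewrite -[X in measurable X]setTI; exact: measurable_funP.
pose k : {nonneg R} := NngNum (fine_ge0 (measure_ge0 nu B)).
have kE : nu B = (k%:num)%:E by rewrite /= fineK// fin_num_measure.
rewrite muleC kE.
apply: (g_sigma_algebra_measure_unique (past s) (@past_measurable s) (fun=> setT)
  (fun=> pastT s) _ (mrestr P mXB) (mscale k P)) => //.
- by apply/seteqP; split => // w _; exists 0%N.
- exact: past_setI.
- move=> C pC; transitivity (k%:num%:E * P C)%E; last by [].
  by rewrite -kE muleC; exact: past_indep0.
- move=> _; apply: (@le_lt_trans _ _ (P (setT `&` X s @^-1` B))); first by [].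
  by rewrite setTI (le_lt_trans (probability_le1 _ _))// ltry.
Qed.

(* Integrating out X_s, with everything that depends on X_0, ..., X_(s-1)
   only held fixed. *)
Lemma integral_freezing s (F : past_type s * R -> \bar R) :
  measurable_fun [set: past_type s * R] F -> (forall z, 0 <= F z)%E ->
  (\int[P]_w F (w, X s w) = \int[P]_w \int[nu]_y F (w, y))%E.
Proof.
move=> mF F0.
pose mu : probability (past_type s) R := distribution P (to_past s).
pose phi (w : Omega) : past_type s * R := (to_past s w, X s w).
have mphi : measurable_fun [set: Omega] phi.
  by apply: measurable_fun_pair => //; exact: measurable_to_past.
transitivity (\int[pushforward P phi]_z F z)%E.
  by rewrite ge0_integral_pushforward.
(* By [past_indep] the joint law of the past and [X s] is a product measure, so Tonelli applies. *)
transitivity (\int[mu \x nu]_z F z)%E.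
  apply: eq_measure_integral => A mA _; apply/esym.
  apply: product_measure_unique => // B C mB mC.
  by rewrite /= /pushforward /=; exact: past_indep.
rewrite fubini_tonelli1//.
rewrite ge0_integral_distribution//=.
- exact: measurable_fun_fubini_tonelli_F.
- by move=> w; exact: integral_ge0.
Qed.

End past.

(** * Records *)

Section record_sequences.
Context (R : realType).
Implicit Types x : nat -> R.

Fixpoint quiet x (s i : nat) : bool :=
  if i is i'.+1 then quiet x s i' && (x (s + i'.+1)%N < x s) else true.

(* The record after the one at time [s] occurs at time [s + i.+1]. *)
Definition jump x (s i : nat) : bool :=
  quiet x s i && (x s <= x (s + i.+1)%N).

(* Unlike [record_time x j = t], this is decided by [x 0, ..., x t]. *)
Fixpoint rec_at x (j t : nat) : bool :=
  if j is j'.+1 then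
    has (fun s => rec_at x j' s && jump x s (t - s.+1)) (iota 0 t)
  else (t == 0%N) && (0 <= x 0%N).

Lemma quietP x s i :
  reflect (forall l, (s < l <= s + i)%N -> x l < x s) (quiet x s i).
Proof.
elim: i => [|i IH] /=.
  by apply: ReflectT => l; rewrite addn0; case: ltngtP.
apply: (iffP andP) => [[/IH qi xi] l|q].
  move=> /andP[sl]; rewrite addnS leq_eqVlt ltnS => /orP[/eqP->|li].
    by rewrite -addnS.
  by apply: qi; rewrite sl.
split; last by apply: q; rewrite addnS ltnS leq_addr/=.
by apply/IH => l /andP[sl li]; apply: q; rewrite sl addnS (leq_trans li).
Qed.

Lemma jump_next_record x s i : jump x s i -> next_record x s = (s + i.+1)%N.
Proof.
move=> /andP[/quietP q xsi]; rewrite /next_record.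
case: pselect => [ex|]; last first.
  by case; exists (s + i.+1)%N; rewrite xsi addnS ltnS leq_addr.
case: ex_minnP => l /andP[sl xl] lmin; apply/eqP; rewrite eqn_leq.
rewrite lmin ?xsi ?addnS ?ltnS ?leq_addr//= ltnNge; apply/negP => li.
by have := q l; rewrite sl li => /(_ isT); rewrite ltNge xl.
Qed.

(** A partial converse of [jump_next_record]: the condition [s < t] rules out the default value [s],
    returned when no later record exists. *)
Lemma next_record_gt_jump x s t : (s < t)%N -> next_record x s = t ->
  jump x s (t - s.+1).
Proof.
rewrite /next_record => st; case: pselect => [ex|_ ts]; last first.
  by rewrite ts ltnn in st.
case: ex_minnP => l /andP[sl xl] lmin lt; subst l.
rewrite /jump -subSn// subSS subnKC ?(ltnW st)// xl andbT.
apply/quietP => l /andP[sl' lt]; rewrite ltNge; apply/negP => xsl.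
have := lmin l; rewrite sl' xsl => /(_ isT); lia.
Qed.

Lemma next_record_ge x s : (s <= next_record x s)%N /\ x s <= x (next_record x s).
Proof.
rewrite /next_record; case: pselect => [ex|//].
by case: ex_minnP => l /andP[/ltnW].
Qed.

(** True on every path: where a record is missing, the default keeps the current value. *)
Lemma record_range_ge0 x n : 0 <= record_range x n.
Proof.
rewrite /record_range /record_value subr_ge0.
elim: n.-1 => [//|j IH] /=; exact: le_trans IH (next_record_ge _ _).2.
Qed.

Lemma rec_atS x j s i : rec_at x j s -> jump x s i -> rec_at x j.+1 (s + i.+1).
Proof.
move=> rs js; apply/hasP; exists s; first by rewrite mem_iota; lia.
apply/andP; split; first exact: rs.
by rewrite (_ : (s + i.+1 - s.+1)%N = i)//; lia.
Qed.

Lemma rec_atSE x j t : rec_at x j.+1 t ->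
  exists s i, [/\ rec_at x j s, jump x s i & t = (s + i.+1)%N].
Proof.
move=> /hasP[s]; rewrite mem_iota => /andP[_ st] /andP[rs js].
by exists s, (t - s.+1)%N; split => //; lia.
Qed.

(** Only this direction holds: [record_time] can stall by default, and [rec_at] also asks for
    [0 <= x 0]. *)
Lemma rec_at_record_time x j t : rec_at x j t -> record_time x j = t.
Proof.
elim: j t => [t /andP[/eqP-> //]|j IH t /rec_atSE[s [i [rs js ->]]]] /=.
by rewrite (IH _ rs); exact: jump_next_record.
Qed.

(** Records never go below [x 0], which [rec_at] requires to be nonnegative. Lack of memory at a
    record value needs this sign. *)
Lemma rec_at_ge0 x j t : rec_at x j t -> 0 <= x t.
Proof.
elim: j t => [t /andP[/eqP-> //]|j IH t /rec_atSE[s [i [rs js ->]]]] /=.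
by move/andP : js => [_]; apply: le_trans; exact: IH rs.
Qed.

End record_sequences.

(** * Measurability of records, with respect to the past where possible *)

Section record_measurability.
Context (disp : measure_display) (Omega : measurableType disp) (R : realType).
Variables (X : nat -> {mfun Omega >-> R}).
Notation past_type s := (g_sigma_algebraType (past X s)).
Notation path w := (fun i => X i w).

Lemma measurable_quiet s i :
  measurable_fun [set: past_type (s + i.+1)] (fun w => quiet (path w) s i).
Proof.
elim: i => [|i IH] /=; first exact: measurable_cst.
apply: measurable_and; first by apply: measurable_past_fun IH; rewrite leq_add2l.
by apply: measurable_fun_ltr; apply: measurable_past_X; lia.
Qed.

Lemma measurable_jump s i :
  measurable_fun [set: past_type (s + i.+2)] (fun w => jump (path w) s i).
Proof.
apply: measurable_and.
  by apply: (measurable_past_fun _ (@measurable_quiet s i)); lia.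
by apply: measurable_fun_ler; apply: measurable_past_X; lia.
Qed.

Lemma measurable_rec_at j t :
  measurable_fun [set: past_type t.+1] (fun w => rec_at (path w) j t).
Proof.
elim: j t => [t|j IH t] /=.
  apply: measurable_and; first exact: measurable_cst.
  by apply: measurable_fun_ler => //; exact: measurable_past_X.
have : all (fun s => s < t)%N (iota 0 t).
  by apply/allP => s; rewrite mem_iota add0n.
elim: (iota 0 t) => [_|s l IHl /= /andP[st /IHl ml]]; first exact: measurable_cst.
apply: measurable_or => //; apply: measurable_and.
  by apply: (measurable_past_fun _ (IH s)); lia.
by apply: (measurable_past_fun _ (@measurable_jump s _)); lia.
Qed.

Lemma measurable_set_bool (b : Omega -> bool) :
  measurable_fun [set: Omega] b -> measurable [set w | b w].
Proof. by move=> mb; rewrite -[X in measurable X]setTI; exact: (mb measurableT [set true]). Qed.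

Lemma measurable_record_time_eq j t :
  measurable [set w | record_time (path w) j = t].
Proof.
elim: j t => [t|j IH t] /=.
  by case: t => [|t]; [rewrite (_ : mkset _ = setT)|rewrite (_ : mkset _ = set0)];
    rewrite //; apply/seteqP; split.
rewrite (_ : [set w | _] = \bigcup_(s in `I_t.+1)
   ([set w | record_time (path w) j = s] `&` [set w | next_record (path w) s = t])).
  apply: bigcup_measurable => s /= st; apply: measurableI => //.
  (* If the previous record time is already [t], then [next_record] returns [t] only by default,
     that is, when there is no jump from [t] at all. *)
  move: st; rewrite ltnS leq_eqVlt => /orP[/eqP->|st].
    rewrite (_ : [set w | _] = ~` \bigcup_i [set w | jump (path w) t i]).
      apply: measurableC; apply: bigcupT_measurable => i.
      apply: measurable_set_bool; exact: measurable_past (@measurable_jump _ _).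
    apply/seteqP; split => w /=.
      by move=> nt [i _ /jump_next_record]; rewrite nt; lia.
    move=> nj; have [tn _] := next_record_ge (path w) t.
    apply/eqP; rewrite eqn_leq tn andbT leqNgt; apply/negP => tn'; apply: nj.
    exists (next_record (path w) t - t.+1)%N => //=.
    exact: next_record_gt_jump.
  rewrite (_ : [set w | _] = [set w | jump (path w) s (t - s.+1)]).
    apply: measurable_set_bool; exact: measurable_past (@measurable_jump _ _).
  apply/seteqP; split => w /=; first exact: next_record_gt_jump.
  by move/jump_next_record => ->; lia.
apply/seteqP; split => w /=; last by move=> [s _ [-> ]].
move=> rt; exists (record_time (path w) j) => //=.
by rewrite ltnS -rt; exact: (next_record_ge _ _).1.
Qed.

Lemma measurable_record_range n :
  measurable_fun [set: Omega] (fun w => record_range (path w) n).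
Proof.
move=> _ B mB; rewrite setTI.
(* The range is [X t - X 0] on each of the countably many events fixing the record time. *)
rewrite (_ : _ @^-1` _ = \bigcup_t ([set w | record_time (path w) n.-1 = t] `&`
    (fun w => X t w - X 0 w) @^-1` B)); last first.
  apply/seteqP; split => w; last by move=> [t _ [/= rt]]; rewrite -rt.
  by move=> Bw; exists (record_time (path w) n.-1).
apply: bigcupT_measurable => t; apply: measurableI.
  exact: measurable_record_time_eq.
rewrite -[X in measurable X]setTI.
by apply: measurable_funB => //; exact: measurable_funP.
Qed.

End record_measurability.

Lemma measurable_fun_fst d1 d2 d3 (T1 : measurableType d1)
    (T2 : measurableType d2) (U : measurableType d3) (f : T1 -> U) :
  measurable_fun [set: T1] f -> measurable_fun [set: T1 * T2] (fun z => f z.1).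
Proof. by move=> mf; exact: measurableT_comp mf measurable_fst. Qed.

(** * Record ranges as a random walk, for a memoryless step law [nu] with tail [q] *)

Section record_law.
Context (disp : measure_display) (Omega : measurableType disp) (R : realType).
Variables (X : nat -> {mfun Omega >-> R}) (P : probability Omega R).
Variables (nu : probability R R) (q : R -> R).
Hypothesis X_indep : mutually_independent P X.
Hypothesis X_law : forall i A, measurable A -> P (X i @^-1` A) = nu A.
Hypothesis nu_ge0 : nu [set x | x < 0] = 0%E.
Hypothesis measurable_q : measurable_fun [set: R] q.
Hypothesis q_gt0 : forall x, 0 < q x.
Hypothesis nu_tail : forall x, nu `[x, +oo[%classic = (q x)%:E.
Hypothesis memoryless : forall (x : R) (f : R -> \bar R), 0 <= x ->
  measurable_fun [set: R] f -> (forall y, 0 <= f y)%E ->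
  (\int[nu]_(y in `[x, +oo[) f y = (q x)%:E * \int[nu]_y f (x + y)%R)%E.
Notation past_type s := (g_sigma_algebraType (past X s)).
Notation path w := (fun i => X i w).

Local Lemma q_le1 x : q x <= 1.
Proof. by rewrite -lee_fin -nu_tail probability_le1. Qed.

Local Lemma nu_lt x : nu `]-oo, x[%classic = (1 - q x)%:E.
Proof.
by rewrite -setCitvr probability_setC// EFinB nu_tail.
Qed.

(** Integrating out the last observation, which must stay below [X s], gives the factor
    [1 - q (X s)]; this factor is absorbed into [K] before the induction hypothesis is used. *)
Lemma integral_quiet s i (K : Omega -> \bar R) :
  measurable_fun [set: past_type s.+1] K -> (forall w, 0 <= K w)%E ->
  (\int[P]_w (if quiet (path w) s i then K w else 0) =
   \int[P]_w (K w * ((1 - q (X s w)) ^+ i)%:E))%E.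
Proof.
elim: i K => [|i IH] K mK K0.
  by apply: eq_integral => w _; rewrite /= expr0 mule1.
pose t := (s + i.+1)%N.
have mqX : measurable_fun [set: past_type s.+1] (fun w => (1 - q (X s w))%:E).
  apply/measurable_EFinP; apply: measurable_funB => //.
  by apply: (measurableT_comp measurable_q); exact: measurable_past_X.
pose F (z : past_type t * R) : \bar R :=
  if quiet (path z.1) s i && (z.2 < X s z.1) then K z.1 else 0%E.
have mF : measurable_fun [set: past_type t * R] F.
  apply: measurable_fun_ifT => //; last first.
    apply: (@measurable_fun_fst _ _ _ (past_type t) R _ K).
    by apply: measurable_past_fun mK; rewrite /t; lia.
  apply: measurable_and.
    exact: (measurable_fun_fst (@measurable_quiet _ _ _ X s i)).
  apply: measurable_fun_ltr; first exact: measurable_snd.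
  apply: (@measurable_fun_fst _ _ _ (past_type t) R _ (X s)).
  by apply: measurable_past_X; rewrite /t; lia.
transitivity (\int[P]_w F (w, X t w))%E; first by [].
rewrite (integral_freezing X_indep X_law mF); last first.
  by move=> z; rewrite /F; case: ifP.
transitivity (\int[P]_w
    (if quiet (path w) s i then K w * (1 - q (X s w))%:E else 0))%E.
  apply: eq_integral => w _; rewrite /F/=; case: quiet => /=; last first.
    exact: integral0.
  rewrite -nu_lt -integral_cst//= [RHS]integral_mkcond.
  by apply: eq_integral => y _; rewrite patchE/= mem_setE/= in_itv.
rewrite IH//; last 2 first.
- exact: emeasurable_funM.
- by move=> w; rewrite mule_ge0// lee_fin subr_ge0 q_le1.
by apply: eq_integral => w _; rewrite -muleA -EFinM exprS.
Qed.

(** The observation that jumps is integrated out first: by lack of memory at [X s], it contributes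
    [q (X s)] and an overshoot [y] of law [nu]. The quiet period before it then gives the power of
    [1 - q (X s)]. *)
Lemma integral_jump s i (a : Omega -> bool) (f : R -> \bar R) :
  measurable_fun [set: past_type s.+1] a -> (forall w, a w -> 0 <= X s w) ->
  measurable_fun [set: R] f -> (forall y, 0 <= f y)%E ->
  (\int[P]_w (if a w && jump (path w) s i
              then f (X (s + i.+1)%N w - X 0%N w)%R else 0) =
   \int[P]_w (if a w then (\int[nu]_y f (X s w - X 0%N w + y)%R) *
       (q (X s w) * (1 - q (X s w)) ^+ i)%:E else 0))%E.
Proof.
move=> ma a0 mf f0.
pose t := (s + i.+1)%N.
pose M w := (\int[nu]_y f (X s w - X 0%N w + y)%R)%E.
have mXs : measurable_fun [set: past_type s.+1] (X s) by exact: measurable_past_X.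
have mX0 : measurable_fun [set: past_type s.+1] (X 0%N) by exact: measurable_past_X.
have mM : measurable_fun [set: past_type s.+1] M.
  apply: (@measurable_fun_fubini_tonelli_F _ _ (past_type s.+1) R R nu
    (fun z => f (X s z.1 - X 0%N z.1 + z.2)%R)).
    apply: (measurableT_comp mf); apply: measurable_funD; last exact: measurable_snd.
    by apply: (@measurable_fun_fst _ _ _ (past_type s.+1) R _ (X s \- X 0%N)); exact: measurable_funB.
  by move=> z; exact: f0.
have M0 w : (0 <= M w)%E by exact: integral_ge0.
have mq : measurable_fun [set: past_type s.+1] (fun w => (q (X s w))%:E).
  by apply/measurable_EFinP; exact: (measurableT_comp measurable_q).
pose F (z : past_type t * R) : \bar R :=
  if (a z.1 && quiet (path z.1) s i) && (X s z.1 <= z.2)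
  then f (z.2 - X 0%N z.1) else 0%E.
have st : (s.+1 <= t)%N by rewrite /t; lia.
have mF : measurable_fun [set: past_type t * R] F.
  apply: measurable_fun_ifT => //; last first.
    apply: (measurableT_comp mf); apply: measurable_funB; first exact: measurable_snd.
    apply: (@measurable_fun_fst _ _ _ (past_type t) R _ (X 0%N)).
    exact: measurable_past_fun mX0.
  apply: measurable_and; last first.
    apply: measurable_fun_ler; last exact: measurable_snd.
    apply: (@measurable_fun_fst _ _ _ (past_type t) R _ (X s)).
    exact: measurable_past_fun mXs.
  apply: measurable_and.
    apply: (@measurable_fun_fst _ _ _ (past_type t) R _ a).
    exact: measurable_past_fun ma.
  exact: (measurable_fun_fst (@measurable_quiet _ _ _ X s i)).
transitivity (\int[P]_w F (w, X t w))%E.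
  by apply: eq_integral => w _; rewrite /F /jump/= andbA.
rewrite (integral_freezing X_indep X_law mF); last first.
  by move=> z; rewrite /F; case: ifP.
pose K w : \bar R := if a w then (M w * (q (X s w))%:E)%E else 0%E.
transitivity (\int[P]_w (if quiet (path w) s i then K w else 0))%E.
  apply: eq_integral => w _; rewrite /F /K/=.
  case: (boolP (a w)) => /= [aw|_]; last by rewrite integral0; case: ifP.
  case: quiet => /=; last exact: integral0.
  transitivity (\int[nu]_(y in `[X s w, +oo[) f (y - X 0%N w)%R)%E.
    rewrite [RHS]integral_mkcond.
    by apply: eq_integral => y _; rewrite patchE/= mem_setE/= in_itv/= andbT.
  rewrite (memoryless (f := fun y => f (y - X 0%N w)))//; last 2 first.
  - exact: a0.
  - by apply: (measurableT_comp mf); exact: measurable_funB.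
  by rewrite muleC; congr (_ * _)%E; apply: eq_integral => y _; congr f; ring.
rewrite integral_quiet.
- apply: eq_integral => w _; rewrite /K; case: ifP => _; last by rewrite mul0e.
  by rewrite EFinM muleA.
- by apply: measurable_fun_ifT => //; exact: emeasurable_funM.
- by move=> w; rewrite /K; case: ifP => // _; rewrite mule_ge0// lee_fin ltW.
Qed.

(** The weights form the geometric law of the waiting time for a value at least [x], of total mass
    1. *)
Lemma nneseries_geometric (x : R) (c : \bar R) : (0 <= c)%E ->
  (\sum_(i <oo) (c * (q x * (1 - q x) ^+ i)%:E) = c)%E.
Proof.
move=> c0.
have q1 : `|1 - q x| < 1.
  by rewrite ger0_norm ?subr_ge0 ?q_le1// ltrBlDr ltrDl.
have u0 i : 0 <= q x * (1 - q x) ^+ i.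
  by rewrite mulr_ge0 ?(ltW (q_gt0 _))// exprn_ge0// subr_ge0 q_le1.
(* For [c = +oo] the first term is already infinite, as [q x > 0]. *)
case: c c0 => [c c0|_|//]; last first.
  rewrite nneseries_recl//; last by move=> k _; rewrite mule_ge0// lee_fin.
  rewrite expr0 mulr1 mulyr gtr0_sg// mul1e addye// gt_eqF//.
  rewrite (lt_le_trans ltNy0)//.
  by apply: nneseries_ge0 => k _ _; rewrite mule_ge0// lee_fin.
rewrite nneseriesZl//; last by move=> k _; rewrite lee_fin.
rewrite (_ : (\sum_(_ <oo) _)%E = 1%E) ?mule1//.
apply/cvg_lim => //.
have := cvg_geometric_series (a := q x) q1.
rewrite (_ : 1 - (1 - q x) = q x); last by ring.
rewrite divff ?gt_eqF// => h.
rewrite (_ : (fun n => _) = EFin \o series (geometric (q x) (1 - q x))).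
  by apply: cvg_EFin => //; exact: nearW.
by apply/funext => n; rewrite /= sumEFin.
Qed.

(** Summing over the waiting time removes the geometric weights: whatever the value of [X s], the
    overshoot of the next record has law [nu]. *)
Lemma nneseries_jump s (a : Omega -> bool) (f : R -> \bar R) :
  measurable_fun [set: past_type s.+1] a -> (forall w, a w -> 0 <= X s w) ->
  measurable_fun [set: R] f -> (forall y, 0 <= f y)%E ->
  (\sum_(i <oo) \int[P]_(w in [set w | a w && jump (path w) s i])
      f (X (s + i.+1)%N w - X 0%N w)%R =
   \int[P]_(w in [set w | a w]) \int[nu]_y f (X s w - X 0%N w + y)%R)%E.
Proof.
move=> ma a0 mf f0.
pose M w := (\int[nu]_y f (X s w - X 0%N w + y)%R)%E.
have M0 w : (0 <= M w)%E by exact: integral_ge0.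
transitivity (\sum_(i <oo) \int[P]_w
  (if a w then M w * (q (X s w) * (1 - q (X s w)) ^+ i)%:E else 0))%E.
  apply: eq_eseriesr => i _; rewrite -integral_jump// integral_mkcond.
  by apply: eq_integral => w _; rewrite patchE/= mem_setE.
have mX k : measurable_fun [set: Omega] (X k) by exact: measurable_funP.
have mM : measurable_fun [set: Omega] M.
  apply: (@measurable_fun_fubini_tonelli_F _ _ Omega R R nu
    (fun z => f (X s z.1 - X 0%N z.1 + z.2)%R)).
    apply: (measurableT_comp mf); apply: measurable_funD; last exact: measurable_snd.
    by apply: (@measurable_fun_fst _ _ _ Omega R _ (X s \- X 0%N)); exact: measurable_funB.
  by move=> z; exact: f0.
have mqX : measurable_fun [set: Omega] (fun w => q (X s w)).
  exact: (measurableT_comp measurable_q).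
rewrite -integral_nneseries//; last 2 first.
- move=> i; apply: measurable_fun_ifT => //; first exact: measurable_past ma.
  apply: emeasurable_funM => //; apply/measurable_EFinP/measurable_funM => //.
  by apply: measurable_funX; exact: measurable_funB.
- move=> i w _; case: ifP => // _; rewrite mule_ge0// lee_fin mulr_ge0 ?(ltW (q_gt0 _))//.
  by rewrite exprn_ge0// subr_ge0 q_le1.
rewrite [RHS]integral_mkcond; apply: eq_integral => w _.
rewrite patchE; have -> : (w \in [set w0 | a w0]) = a w.
  by apply/idP/idP; rewrite inE.
case: (a w); last by rewrite eseries0.
exact: nneseries_geometric.
Qed.

Definition rec_set j t : set Omega := [set w | rec_at (path w) j t].

Lemma measurable_rec_set j t : measurable (rec_set j t).
Proof. exact: measurable_set_bool (measurable_past (@measurable_rec_at _ _ _ X j t)). Qed.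

Lemma trivIset_rec_set j : trivIset setT (rec_set j).
Proof.
move=> s t _ _ [w [/rec_at_record_time <- /rec_at_record_time <-]] //.
Qed.

(** Both sides are split according to the time [s] of record [j], and the left one also according to
    the waiting time [i]; [nneseries_jump] then matches the terms for each [s]. *)
Lemma integral_record_rangeS j (f : R -> \bar R) :
  measurable_fun [set: R] f -> (forall y, 0 <= f y)%E ->
  (\int[P]_(w in \bigcup_t rec_set j.+1 t) f (record_range (path w) j.+2) =
   \int[P]_(w in \bigcup_t rec_set j t)
      \int[nu]_y f (record_range (path w) j.+1 + y)%R)%E.
Proof.
move=> mf f0.
pose E s i : set Omega := [set w | rec_at (path w) j s && jump (path w) s i].
have mE s i : measurable (E s i).
  apply: measurable_set_bool; apply: measurable_and.
    exact: measurable_past (@measurable_rec_at _ _ _ X j s).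
  exact: measurable_past (@measurable_jump _ _ _ X s i).
have mUE s : measurable (\bigcup_i E s i) by exact: bigcupT_measurable.
have EU : \bigcup_t rec_set j.+1 t = \bigcup_s \bigcup_i E s i.
  apply/seteqP; split => w.
    move=> [t _ /rec_atSE[s [i [rs js _]]]]; exists s => //; exists i => //.
    by rewrite /E/= rs.
  move=> [s _ [i _ /andP[rs js]]]; exists (s + i.+1)%N => //.
  exact: rec_atS.
have mfR n : measurable_fun [set: Omega] (fun w => f (record_range (path w) n)).
  exact: (measurableT_comp mf (measurable_record_range X n)).
have mM : measurable_fun [set: Omega]
    (fun w => \int[nu]_y f (record_range (path w) j.+1 + y)%R)%E.
  apply: (@measurable_fun_fubini_tonelli_F _ _ Omega R R nu
    (fun z => f (record_range (path z.1) j.+1 + z.2)%R)).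
    apply: (measurableT_comp mf); apply: measurable_funD; last exact: measurable_snd.
    apply: (@measurable_fun_fst _ _ _ Omega R _ (fun w => record_range (path w) j.+1)).
    exact: measurable_record_range.
  by move=> z; exact: f0.
rewrite EU ge0_integral_bigcup//; last 2 first.
- exact: measurable_funTS.
- move=> s t _ _ [w [[i _ /andP[rs _]] [k _ /andP[rt _]]]].
  by rewrite -(rec_at_record_time rs) -(rec_at_record_time rt).
rewrite ge0_integral_bigcup//; last 4 first.
- exact: measurable_rec_set.
- exact: measurable_funTS.
- by move=> w _; exact: integral_ge0.
- exact: trivIset_rec_set.
apply: eq_eseriesr => s _.
transitivity (\int[P]_(w in [set w | rec_at (path w) j s])
   \int[nu]_y f (X s w - X 0%N w + y)%R)%E; last first.
  apply: eq_integral => w; rewrite inE => /= /rec_at_record_time rs.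
  by apply: eq_integral => y _; rewrite /record_range /record_value/= rs.
rewrite -nneseries_jump//; last 2 first.
- exact: measurable_rec_at.
- by move=> w; exact: rec_at_ge0.
rewrite ge0_integral_bigcup//; last 2 first.
- exact: measurable_funTS.
- move=> i k _ _ [w [/andP[_ /jump_next_record ji] /andP[_ /jump_next_record jk]]].
  by move: jk; rewrite ji => /addnI [].
apply: eq_eseriesr => i _; apply: eq_integral => w; rewrite inE => /= /andP[rs js].
rewrite /record_range /record_value/= (rec_at_record_time rs).
by rewrite (jump_next_record js).
Qed.

Lemma prob_rec_set j : P (\bigcup_t rec_set j t) = 1%E.
Proof.
elim: j => [|j <-]; last first.
  (* For [f] constant equal to 1 the recurrence says that one more record occurs with the same
     probability. *)
  have := @integral_record_rangeS j (cst 1%E) (@measurable_cst _ _ _ _ _ _) (fun=> lee01).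
  rewrite integral_cst//; last exact: bigcupT_measurable (measurable_rec_set _).
  rewrite mul1e => ->; rewrite -[RHS]mul1e -integral_cst; last first.
    exact: bigcupT_measurable (measurable_rec_set _).
  apply: eq_integral => w _.
  apply: etrans (integral_cst nu measurableT 1) _.
  by rewrite mul1e; exact: probability_setT.
have -> : \bigcup_t rec_set 0 t = ~` (X 0%N @^-1` [set x | x < 0]).
  apply/seteqP; split => w /=; first by move=> [t _ /andP[_]]; rewrite leNgt => /negP.
  by move=> /negP; rewrite -leNgt => Xw; exists 0%N => //; exact/andP.
have mlt : measurable [set x : R | x < 0] by rewrite -set_itvNyo.
rewrite probability_setC.
  by rewrite X_law// nu_ge0 sube0.
by rewrite -[X in measurable X]setTI; exact: measurable_funP.
Qed.

Lemma integral_rec_set j (g : Omega -> \bar R) :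
  measurable_fun [set: Omega] g -> (forall w, 0 <= g w)%E ->
  (\int[P]_w g w = \int[P]_(w in \bigcup_t rec_set j t) g w)%E.
Proof.
move=> mg g0.
have mD : measurable (\bigcup_t rec_set j t).
  exact: bigcupT_measurable (measurable_rec_set _).
rewrite (@ge0_negligible_integral _ _ _ P _ (~` \bigcup_t rec_set j t))//.
- by rewrite setDE setCK setTI.
- exact: measurableC.
- by rewrite [LHS]probability_setC// prob_rec_set subee.
Qed.

(** The random walk property: a new record adds an independent step of law [nu]. The events of
    [integral_record_rangeS] have probability 1, so the integrals may be taken over the whole
    space. *)
Theorem integral_record_range_recurrence j (f : R -> \bar R) :
  measurable_fun [set: R] f -> (forall y, 0 <= f y)%E ->
  (\int[P]_w f (record_range (path w) j.+2) =
   \int[P]_w \int[nu]_y f (record_range (path w) j.+1 + y)%R)%E.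
Proof.
move=> mf f0.
rewrite (@integral_rec_set j.+1)//; last first.
  exact: (measurableT_comp mf (measurable_record_range X _)).
rewrite (@integral_rec_set j); last 2 first.
- apply: (@measurable_fun_fubini_tonelli_F _ _ Omega R R nu
    (fun z => f (record_range (path z.1) j.+1 + z.2)%R)).
    apply: (measurableT_comp mf); apply: measurable_funD; last exact: measurable_snd.
    apply: (@measurable_fun_fst _ _ _ Omega R _ (fun w => record_range (path w) j.+1)).
    exact: measurable_record_range.
  by move=> z; exact: f0.
- by move=> w; exact: integral_ge0.
exact: integral_record_rangeS.
Qed.

End record_law.

(* [R] and [measurableTypeR R] carry the same measurable sets under different
   displays, hence the detour through a pushforward along the identity. *)
Lemma integral_exponential_law (R : realType) (nu : probability R R) (r : R)
    (D : set R) (f : R -> \bar R) : 0 < r ->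
  (forall A, measurable A -> nu A = exponential_prob r A) ->
  measurable D -> measurable_fun [set: R] f -> (forall y, 0 <= f y)%E ->
  (\int[nu]_(y in D) f y = \int[exponential_prob r]_(y in D) f y)%E.
Proof.
move=> r0 nuE mD mf f0.
pose idTR : measurableTypeR R -> R := idfun.
have midTR : measurable_fun [set: measurableTypeR R] idTR.
  by move=> _ A mA; rewrite setTI.
transitivity (\int[pushforward (exponential_prob r) idTR]_(y in D) f y)%E.
  by apply: eq_measure_integral => // A mA _; exact: nuE.
rewrite ge0_integral_pushforward//.
exact: measurable_funTS.
Qed.

(** * Record ranges of exponential observations and change of rate *)

Section exponential_records.
Context (disp : measure_display) (Omega : measurableType disp) (R : realType).
Variables (X : nat -> {mfun Omega >-> R}).
Notation path w := (fun i => X i w).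

Lemma exponential_record_recurrence (P : probability Omega R) (delta : R) j
    (f : R -> \bar R) : 0 < delta -> iid_exponential P X delta ->
  measurable_fun [set: R] f -> (forall y, 0 <= f y)%E ->
  (\int[P]_w f (record_range (path w) j.+2) =
   \int[P]_w \int[exponential_prob delta^-1]_y
      f (record_range (path w) j.+1 + y)%R)%E.
Proof.
move=> delta0 [X_indep X_law] mf f0.
have r0 : 0 < delta^-1 by rewrite invr_gt0.
(* The maximum makes this the tail of the exponential law also at negative [x], where it equals
   1. *)
pose q (x : R) := expR (- delta^-1 * Num.max 0 x).
pose nu : probability R R := distribution P (X 0%N).
have nuE A : measurable A -> nu A = exponential_prob delta^-1 A by exact: X_law.
have nuI := integral_exponential_law r0 nuE.
transitivity (\int[P]_w \int[nu]_y f (record_range (path w) j.+1 + y)%R)%E.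
  apply: (@integral_record_range_recurrence _ _ _ X P nu q) => //.
  - by move=> i A mA; rewrite nuE//; exact: X_law.
  - by rewrite nuE ?exponential_prob_lt0// -set_itvNyo.
  - apply: measurableT_comp => //; apply: measurable_funM => //.
    exact: measurable_maxr.
  - by move=> x; exact: expR_gt0.
  - move=> x; rewrite nuE// /q; have [x0|x0] := leP 0 x.
      exact: exponential_prob_itvcy.
    rewrite mulr0 expR0 -nuE//; apply/eqP; rewrite eq_le probability_le1//=.
    have <- : nu `[0, +oo[%classic = 1%E.
      by rewrite nuE// exponential_prob_itvcy// mulr0 expR0.
    by apply: le_measure; rewrite ?inE//; apply: subset_itvr; rewrite bnd_simp ltW.
  - move=> x g x0 mg g0; rewrite !nuI//; last first.
      by apply: (measurableT_comp mg); exact: measurable_funD.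
    by rewrite /q max_r//; exact: exponential_memoryless.
apply: eq_integral => w _; rewrite nuI//.
by apply: (measurableT_comp mf); exact: measurable_funD.
Qed.

(** Each step of the walk contributes a factor $r e^{-(r-1)y}$, and these factors multiply to a
    function of the sum alone. The range with index [j.+1] has [j] steps; with index 1 it is 0. *)
Theorem integral_record_range_tilt (P1 Pr : probability Omega R) (r : R) j
    (f : R -> \bar R) : 0 < r ->
  iid_exponential P1 X 1 -> iid_exponential Pr X r^-1 ->
  measurable_fun [set: R] f -> (forall y, 0 <= f y)%E ->
  (\int[Pr]_w f (record_range (path w) j.+1) =
   \int[P1]_w (f (record_range (path w) j.+1) *
     (r ^+ j * expR (- (r - 1) * record_range (path w) j.+1))%:E))%E.
Proof.
move=> r0 X1 Xr; elim: j f => [|j IH] f mf f0.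
  have R0 w : record_range (path w) 1 = 0 by rewrite /record_range subrr.
  under eq_integral do rewrite R0.
  under [RHS]eq_integral do rewrite R0 mulr0 expR0 mulr1 expr0 mule1.
  have cstI (Q : probability Omega R) : (\int[Q]_w f 0%R = f 0%R)%E.
    apply: etrans (integral_cst Q measurableT (f 0)) _.
    by rewrite [X in (_ * X)%E]probability_setT mule1.
  by rewrite !cstI.
have mexp : measurable_fun [set: R] (fun y : R => expR (- (r - 1) * y)).
  by apply: measurableT_comp => //; exact: measurable_funM.
have ri0 : 0 < r^-1 by rewrite invr_gt0.
have mfD u : measurable_fun [set: R] (fun y => f (u + y)).
  by apply: (measurableT_comp mf); exact: measurable_funD.
(* The last step is averaged out at rate [r]; the induction hypothesis is then applied to [g]. *)
pose g u := (\int[exponential_prob r]_y f (u + y)%R)%E.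
rewrite (exponential_record_recurrence _ ri0 Xr)// invrK.
have gE u : g u = (r%:E * \int[exponential_prob 1]_y
    (f (u + y)%R * (expR (- (r - 1) * y))%:E))%E.
  by rewrite /g exponential_tilt.
have mg : measurable_fun [set: R] g.
  pose nu : probability R R := distribution Pr (X 0%N).
  have nuE A : measurable A -> nu A = exponential_prob r A.
    by rewrite -[r]invrK; exact: Xr.2.
  rewrite (_ : g = fubini_F nu (fun z : R * R => f (z.1 + z.2)%R)); last first.
    apply/funext => u; apply/esym; apply: integral_exponential_law => //.
    exact: mfD.
  apply: measurable_fun_fubini_tonelli_F => //.
  by apply: (measurableT_comp mf); exact: measurable_funD.
rewrite (IH g)//; last by move=> u; exact: integral_ge0.
(* The integrand of the right-hand side, to which the recurrence at rate 1 is applied. *)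
pose F v := (f v * (r ^+ j.+1 * expR (- (r - 1) * v))%:E)%E.
have mF : measurable_fun [set: R] F.
  by apply: emeasurable_funM => //; apply/measurable_EFinP; exact: measurable_funM.
have F0 v : (0 <= F v)%E.
  by rewrite mule_ge0// lee_fin mulr_ge0 ?expR_ge0// exprn_ge0// ltW.
rewrite [RHS](exponential_record_recurrence (f := F) _ ltr01 X1)// invr1.
apply: eq_integral => w _; set u := record_range _ _.
rewrite gE muleAC -EFinM -ge0_integralZl//.
- apply: eq_integral => y _; rewrite muleCA -EFinM; congr (_ * _%:E)%E.
  by rewrite (mulrDr _ u y) (expRD (_ * u)) exprS; ring.
- apply: emeasurable_funM; first exact: mfD.
  by apply/measurable_EFinP; exact: mexp.
- by move=> y _; rewrite mule_ge0// lee_fin expR_ge0.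
- by rewrite lee_fin !mulr_ge0 ?expR_ge0 ?exprn_ge0// ltW.
Qed.

End exponential_records.

(** * Admissibility *)

Section differential_inequality.
Context (R : realType).

Lemma ge0_derive_le (f f' : R -> R) (a b : R) : a <= b ->
  (forall x : R, a <= x <= b -> is_derive x 1 f (f' x)) ->
  (forall x : R, a < x < b -> 0 <= f' x) -> f a <= f b.
Proof.
rewrite le_eqVlt => /orP[/eqP-> //|ab] df f'0.
have [x||c] := @MVT R f f' a b ab.
- by rewrite in_itv/= => /andP[/ltW ax /ltW xb]; apply: df; rewrite ax.
- by apply: derivable_within_continuous => x; rewrite in_itv/= => /df[].
rewrite in_itv/= => cab fE; rewrite -subr_ge0 fE mulr_ge0 ?f'0//.
by rewrite subr_ge0 ltW.
Qed.

Variables (J K Q : R -> R) (k : nat) (m d C : R).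
Hypothesis m_ge0 : 0 <= m.
Hypothesis m_le : m * k.+1%:R <= 1.
Hypothesis d_gt0 : 0 < d.
Hypothesis J_derive : forall t : R, 0 < t -> is_derive t 1 J (- K t).
Hypothesis Q_ge0 : forall t, 0 < t -> 0 <= Q t.
Hypothesis J_sqr : forall t, 0 < t -> J t ^+ 2 * t ^+ k <= Q t.
Hypothesis J_bounded : forall t, 1 <= t -> `|J t| <= C.
Hypothesis Q_le : forall t, 0 < t ->
  t * Q t <= 2 * ((1 - d * t) * J t - m * t * K t).

Lemma differential_inequality : exists2 t, 0 < t & Q t <= 0.
Proof.
have [m0|m_gt0] := leP m 0.
  have m0' : m = 0 by apply/eqP; rewrite eq_le m0.
  exists d^-1; first by rewrite invr_gt0.
  have := Q_le (t := d^-1); rewrite invr_gt0 => /(_ d_gt0).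
  rewrite m0' divff ?gt_eqF// subrr !mul0r subr0 mulr0.
  by rewrite pmulr_rle0// invr_gt0.
pose p := m^-1; pose b := d / m.
have p0 : 0 < p by rewrite invr_gt0.
have b0 : 0 < b by rewrite divr_gt0.
(* The integrating factor $t^p e^{-bt}$: its logarithmic derivative $p/t - b = (1 - dt)/(mt)$ is the
   coefficient of [J] in [Q_le] after division by $2mt$. *)
pose W t := expR (p * ln t - b * t).
have W0 t : 0 < W t by exact: expR_gt0.
pose H t := W t * J t.
pose H' t := W t * ((p / t - b) * J t - K t).
have dH (t : R) : 0 < t -> is_derive t 1 H (H' t).
  move=> t0; have := J_derive t0 => dJ; rewrite /H /W.
  have dl := is_derive1_ln t0.
  apply: is_derive_eq.
  by rewrite /H' /W !scaler1/= /GRing.scale/=; ring.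
have H'_ge t : 0 < t -> W t * Q t / (2 * m) <= H' t.
  move=> t0; rewrite /H' -mulrA ler_pM2l//.
  rewrite -(ler_pM2l (_ : 0 < 2 * m * t)); last by rewrite !mulr_gt0.
  rewrite (_ : 2 * m * t * _ = t * Q t); last by field; rewrite gt_eqF.
  rewrite (_ : 2 * m * t * _ = 2 * ((1 - d * t) * J t - m * t * K t)); last first.
    by rewrite /p /b; field; rewrite !gt_eqF.
  exact: Q_le.
have H'_ge0 t : 0 < t -> 0 <= H' t.
  move=> t0; apply: le_trans (H'_ge _ t0).
  by rewrite divr_ge0 ?mulr_ge0 ?Q_ge0// ltW.
have ndH s t : 0 < s -> s <= t -> H s <= H t.
  move=> s0 st; apply: (ge0_derive_le (f' := H') st) => x /andP[sx _].
    by apply: dH; exact: lt_le_trans sx.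
  by apply: H'_ge0; exact: lt_trans sx.
have H_le0 s : 0 < s -> H s <= 0.
  move=> s0; rewrite leNgt; apply/negP => Hs.
  (* From $\ln(et) \le et - 1$ one gets $p \ln t \le pet - p - p \ln e$. This [e] makes $pe = b/2$,
     so half of the exponential decay of [W] survives. *)
  pose e := b / (2 * p).
  have e0 : 0 < e by rewrite divr_gt0// mulr_gt0.
  pose c := p * (- 1 - ln e).
  have lnle t : 0 < t -> p * ln t - b * t <= c - b / 2 * t.
    move=> t0; have := le_ln1Dx (x := e * t - 1).
    rewrite ltrBrDr addrC subrr mulr_gt0// => /(_ isT).
    rewrite (_ : 1 + (e * t - 1) = e * t); last by ring.
    rewrite lnM ?posrE// => h.
    have : p * (ln e + ln t) <= p * (e * t - 1) by rewrite ler_pM2l.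
    rewrite (_ : p * (e * t - 1) = b / 2 * t - p); last first.
      by rewrite /e; field; rewrite gt_eqF.
    by rewrite /c; nra.
  have C0 : 0 <= C by exact: le_trans (normr_ge0 _) (J_bounded (lexx 1)).
  (* Here [H s <= H t <= W t * C], and $1 + bt/2 \le e^{bt/2}$ uses up the remaining decay of [W]. A
     positive [H s] makes the left side unbounded in [t]. *)
  have bnd t : 1 <= t -> s <= t -> H s * (1 + b / 2 * t) <= expR c * C.
    move=> t1 st; have t0 : 0 < t by exact: lt_le_trans t1.
    have HW : H s <= W t * C.
      apply: (le_trans (ndH _ _ s0 st)); rewrite /H ler_pM2l//.
      exact: le_trans (ler_norm _) (J_bounded t1).
    have WE : W t * (1 + b / 2 * t) <= expR c.
      apply: (@le_trans _ _ (expR (c - b / 2 * t) * expR (b / 2 * t))).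
        apply: ler_pM; [exact: ltW| |by rewrite ler_expR; exact: lnle|].
          by rewrite addr_ge0// mulr_ge0 ?divr_ge0// ltW.
        exact: expR_ge1Dx.
      by rewrite -expRD subrK.
    apply: (@le_trans _ _ (W t * C * (1 + b / 2 * t))).
      by rewrite ler_wpM2r// addr_ge0// mulr_ge0 ?divr_ge0// ltW.
    by rewrite mulrAC ler_wpM2r.
  pose t := 1 + s + expR c * C / (H s * (b / 2)).
  have Hb : 0 < H s * (b / 2) by rewrite mulr_gt0// divr_gt0.
  have t0 : 0 <= expR c * C / (H s * (b / 2)).
    by rewrite divr_ge0 ?(ltW Hb)// mulr_ge0// expR_ge0.
  have t1 : 1 <= t by rewrite /t; lra.
  have st : s <= t by rewrite /t; lra.
  have := bnd t t1 st; rewrite leNgt => /negP; apply.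
  rewrite (_ : H s * _ = H s + H s * (b / 2) * (1 + s) + expR c * C); last first.
    by rewrite /t; field; rewrite !gt_eqF.
  by rewrite ltrDr addr_gt0// mulr_gt0// addr_gt0.
have H_ge0 s : 0 < s -> 0 <= H s.
  move=> s0; rewrite leNgt; apply/negP => Hs.
  pose t1 := Num.min s 1.
  have t10 : 0 < t1 by rewrite lt_min s0 ltr01.
  have H_lt0 t : 0 < t -> t <= t1 -> H t < 0.
    move=> t0 tt1; apply: le_lt_trans Hs; apply: ndH => //.
    by apply: (le_trans tt1); rewrite ge_min lexx.
  pose c := (2 * m)^-1.
  have c0 : 0 < c by rewrite invr_gt0 mulr_gt0.
  (* The Riccati inequality. For [t <= 1] and [p >= k.+1] one has $W \le t^{k+1}$, so $W J^2 / t \le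
     J^2 t^k \le Q$. *)
  have WH t : 0 < t -> t <= t1 -> c / t * H t ^+ 2 <= H' t.
    move=> t0 tt1; apply: le_trans (H'_ge _ t0).
    have t_le1 : t <= 1 by apply: (le_trans tt1); rewrite ge_min lexx orbT.
    have Wt : W t <= t ^+ k.+1.
      have -> : t ^+ k.+1 = expR (k.+1%:R * ln t).
        by rewrite expRM_natl lnK ?posrE.
      have lnt : ln t <= 0 by exact: ln_le0.
      have pk : k.+1%:R <= p by rewrite /p -[m^-1]mul1r ler_pdivlMr// mulrC.
      have bt : 0 <= b * t by rewrite mulr_ge0// ltW.
      by rewrite ler_expR; nra.
    rewrite (_ : c / t * H t ^+ 2 = c * W t * (W t / t * J t ^+ 2)); last first.
      by rewrite /H; field; rewrite gt_eqF.
    rewrite (_ : W t * Q t / (2 * m) = c * W t * Q t); last by rewrite /c; ring.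
    rewrite ler_wpM2l ?mulr_ge0 ?(ltW c0) ?(ltW (W0 t))//.
    apply: le_trans (J_sqr t0); rewrite mulrC ler_wpM2l ?sqr_ge0//.
    by rewrite ler_pdivrMr// -exprSr.
  (* Dividing the Riccati inequality by [H t ^+ 2] gives [F' >= 0]. As [H < 0], the first term is
     positive while [- c * ln t] blows up at 0, so [F t <= F t1] must fail near 0. *)
  pose F t := - (H t)^-1 - c * ln t.
  pose F' t := (H t) ^- 2 * H' t - c / t.
  have F_le t : 0 < t -> t <= t1 -> F t <= F t1.
    move=> t0 tt1; apply: (ge0_derive_le (f' := F') tt1) => x /andP[tx xt].
      have x0 : 0 < x by exact: lt_le_trans tx.
      have Hx0 := H_lt0 x x0 xt.
      have dHx := dH x x0; have dl := is_derive1_ln x0.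
      have Hn : H x != 0 by rewrite lt_eqF.
      have dV : is_derive x 1 (fun y => (H y)^-1) (- (H x) ^- 2 *: H' x).
        apply: DeriveDef; first by apply: derivableV => //; case: dHx.
        by rewrite deriveV// derive_val.
      rewrite /F; apply: is_derive_eq.
      by rewrite /F' /GRing.scale/=; ring.
    have x0 : 0 < x by exact: lt_trans tx.
    have Hx0 := H_lt0 x x0 (ltW xt).
    rewrite /F' subr_ge0 [leRHS]mulrC ler_pdivlMr; last by rewrite exprn_even_gt0//= lt_eqF.
    by apply: WH => //; exact: ltW.
  (* Small enough that [- c * ln t >= F t1 + c], whence [F t > F t1]. *)
  pose t := Num.min t1 (expR (- (F t1 / c) - 1)).
  have t0 : 0 < t by rewrite lt_min t10 expR_gt0.
  have tt1 : t <= t1 by rewrite ge_min lexx.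
  have := F_le t t0 tt1; rewrite leNgt => /negP; apply.
  have lnt : ln t <= - (F t1 / c) - 1.
    by rewrite -ler_expR lnK ?posrE// ge_min lexx orbT.
  have : c * ln t <= c * (- (F t1 / c) - 1) by rewrite ler_pM2l.
  rewrite (_ : c * (- (F t1 / c) - 1) = - F t1 - c); last by field; rewrite gt_eqF.
  have HV : (H t)^-1 < 0 by rewrite invr_lt0; exact: H_lt0.
  by rewrite [F t]/F; move: (F t1) => z; lra.
have H0 s : 0 < s -> H s = 0 by move=> s0; apply/eqP; rewrite eq_le H_le0// H_ge0.
have J0 s : 0 < s -> J s = 0.
  by move=> /H0 /eqP; rewrite mulf_eq0 gt_eqF//= => /eqP.
have lt12 : 1 < 2 :> R by rewrite ltr1n.
(* Since [J] vanishes on the half-line, the mean value theorem yields a zero of [K], and [Q_le] at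
   that point bounds [Q]. *)
have [x||x] := @MVT R J (fun t => - K t) 1 2 lt12.
- by rewrite in_itv/= => /andP[x1 _]; apply: J_derive; exact: lt_trans x1.
- apply: derivable_within_continuous => x; rewrite in_itv/= => /andP[x1 _].
  by have [] := J_derive (lt_le_trans ltr01 x1).
rewrite in_itv/= => /andP[x1 _]; have x0 : 0 < x by exact: lt_trans x1.
rewrite !J0// => Kx; exists x => //.
have {Kx}Kx : K x = 0 by lra.
by have := Q_le x0; rewrite J0// Kx !mulr0 subr0 mulr0 pmulr_rle0.
Qed.

End differential_inequality.

(** * Integrability and transforms of the correction [h] of a dominating estimator *)

Section dominating_estimator.
Context (disp : measure_display) (Omega : measurableType disp) (R : realType).
Variable mu : probability Omega R.
Variables (Y h : Omega -> R) (k : nat) (m d : R).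
Hypothesis measurable_Y : measurable_fun [set: Omega] Y.
Hypothesis measurable_h : measurable_fun [set: Omega] h.
Hypothesis Y_ge0 : forall w, 0 <= Y w.
Hypothesis m_ge0 : 0 <= m.
Hypothesis m_le : m * k.+1%:R <= 1.
Hypothesis d_gt0 : 0 < d.

(** The density at rate [t] relative to rate 1, without the factor [t ^+ k], which cancels when
    risks are compared. *)
Let g (t : R) w := expR (- (t - 1) * Y w).

Hypothesis g_normalized : forall t, 0 < t ->
  (\int[mu]_w (t ^+ k * g t w)%:E = 1)%E.
Hypothesis dominated : forall t, 0 < t ->
  (\int[mu]_w ((t * (m * Y w + d + h w) - 1) ^+ 2 * g t w)%:E <=
   \int[mu]_w ((t * (m * Y w + d) - 1) ^+ 2 * g t w)%:E)%E.

Local Notation integrableT f := (mu.-integrable [set: Omega] (EFin \o f)).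

Let g_gt0 t w : 0 < g t w. Proof. exact: expR_gt0. Qed.

Let sqr_g_ge0 x t w : 0 <= x ^+ 2 * g t w.
Proof. exact: mulr_ge0 (sqr_ge0 x) (ltW (g_gt0 t w)). Qed.

Let measurable_g t : measurable_fun [set: Omega] (g t).
Proof. by apply: measurableT_comp => //; exact: measurable_funM. Qed.

Let g_le s t w : s <= t -> g t w <= g s w.
Proof. by move=> st; rewrite ler_expR; have := Y_ge0 w; nra. Qed.

Let integrable_le (f1 f2 : Omega -> R) : measurable_fun [set: Omega] f1 ->
  (forall w, `|f1 w| <= f2 w) -> integrableT f2 -> integrableT f1.
Proof.
move=> mf1 f12; apply: le_integrable => //; first exact/measurable_EFinP.
by move=> w _; rewrite /= lee_fin (le_trans (f12 w))// ler_norm.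
Qed.

Let integrableDr (f1 f2 : Omega -> R) : integrableT f1 -> integrableT f2 ->
  integrableT (fun w => f1 w + f2 w).
Proof. by move=> i1 i2; exact: (integrableD measurableT i1 i2). Qed.

Let integrableZr (c : R) (f : Omega -> R) : integrableT f ->
  integrableT (fun w => c * f w).
Proof. by move=> i; exact: (integrableZl measurableT c i). Qed.

Let integrable_ge0 (f : Omega -> R) : measurable_fun [set: Omega] f ->
  (forall w, 0 <= f w) -> (\int[mu]_w (f w)%:E < +oo)%E -> integrableT f.
Proof.
move=> mf f0 foo; apply/integrableP; split; first exact/measurable_EFinP.
by under eq_integral do rewrite /= ger0_norm//.
Qed.

Let integrable_g t : 0 < t -> integrableT (g t).
Proof.
move=> t0; have : integrableT (fun w => t ^+ k * g t w).
  apply: integrable_ge0.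
  - exact: measurable_funM.
  - by move=> w; rewrite mulr_ge0 ?exprn_ge0 ?(ltW t0) ?(ltW (g_gt0 _ _)).
  - by rewrite g_normalized// ltry.
move=> /(integrableZr (t ^- k)); apply: eq_integrable => // w _ /=.
by rewrite mulrA mulVf ?mul1r// expf_neq0// gt_eqF.
Qed.

Let Rintegral_g t : 0 < t -> \int[mu]_w (g t w) = t ^- k.
Proof.
move=> t0; have tk0 : t ^+ k != 0 by rewrite expf_neq0// gt_eqF.
apply: (mulfI tk0); rewrite -RintegralZl//; last exact: integrable_g.
by rewrite /Rintegral g_normalized// mulfV.
Qed.

(** Half of the rate absorbs the square: $u^2/2 \le e^u$ at $u = tY/2$ gives $Y^2 \le (8/t^2)
    e^{tY/2}$, and $e^{tY/2}$ times [g t] is [g (t / 2)]. *)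
Let integrable_Y2g t : 0 < t -> integrableT (fun w => Y w ^+ 2 * g t w).
Proof.
move=> t0; have t20 : 0 < t / 2 by rewrite divr_gt0.
apply: integrable_le (integrableZr (8 / t ^+ 2) (integrable_g t20)).
  by apply: measurable_funM => //; exact: measurable_funX.
move=> w; rewrite ger0_norm ?sqr_g_ge0//.
have u0 : 0 <= t / 2 * Y w by rewrite mulr_ge0// ltW.
have := expR_ge1Dxn 1 u0; set e := expR _ => he.
rewrite (_ : g (t / 2) w = e * g t w); last first.
  by rewrite /e /g -expRD; congr expR; field.
rewrite mulrA ler_wpM2r ?(ltW (g_gt0 _ _))//.
rewrite mulrAC ler_pdivlMr ?exprn_gt0//.
have : (t / 2 * Y w) ^+ 2 / 2 <= e by apply: le_trans he; rewrite lerDr.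
by rewrite !exprMn; lra.
Qed.

Let mean_integrable t c1 c2 : 0 < t ->
  integrableT (fun w => (c1 * Y w ^+ 2 + c2) * g t w).
Proof.
move=> t0; have := integrableDr (integrableZr c1 (integrable_Y2g t0))
  (integrableZr c2 (integrable_g t0)).
by apply: eq_integrable => // w _ /=; rewrite mulrDl mulrA.
Qed.

Let integrable_linear_loss t : 0 < t ->
  integrableT (fun w => (t * (m * Y w + d) - 1) ^+ 2 * g t w).
Proof.
move=> t0; apply: integrable_le
  (mean_integrable (2 * (t * m) ^+ 2) (2 * (t * d - 1) ^+ 2) t0).
  apply: measurable_funM => //; apply: measurable_funX; apply: measurable_funB => //.
  by apply: measurable_funM => //; apply: measurable_funD => //; exact: measurable_funM.
move=> w; rewrite ger0_norm ?sqr_g_ge0//.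
rewrite ler_wpM2r ?(ltW (g_gt0 _ _))// -subr_ge0.
rewrite (_ : _ - _ = (t * m * Y w - (t * d - 1)) ^+ 2) ?sqr_ge0//; ring.
Qed.

(** The competing risk is finite because it is at most that of the linear estimator. *)
Let integrable_loss t : 0 < t ->
  integrableT (fun w => (t * (m * Y w + d + h w) - 1) ^+ 2 * g t w).
Proof.
move=> t0; apply: integrable_ge0.
- apply: measurable_funM => //; apply: measurable_funX; apply: measurable_funB => //.
  apply: measurable_funM => //; apply: measurable_funD => //.
  by apply: measurable_funD => //; exact: measurable_funM.
- by move=> w; exact: sqr_g_ge0.
- apply: le_lt_trans (dominated t0) _.
  by apply: integrable_lty => //; exact: integrable_linear_loss.
Qed.

(** [t * h w] is the difference of the two errors whose squares are integrable, and $(a - b)^2 \le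
    2a^2 + 2b^2$. *)
Let integrable_h2g t : 0 < t -> integrableT (fun w => h w ^+ 2 * g t w).
Proof.
move=> t0; apply: integrable_le
  (integrableZr (2 / t ^+ 2) (integrableDr (integrable_loss t0) (integrable_linear_loss t0))).
  by apply: measurable_funM => //; exact: measurable_funX.
move=> w; rewrite ger0_norm ?sqr_g_ge0//.
rewrite -mulrDl mulrA ler_wpM2r ?(ltW (g_gt0 _ _))//.
rewrite mulrAC ler_pdivlMr ?exprn_gt0//.
set u := m * Y w + d; rewrite -subr_ge0.
rewrite (_ : _ - _ = (t * (u + h w) - 1 + (t * u - 1)) ^+ 2) ?sqr_ge0//; ring.
Qed.

Let integrable_hg t : 0 < t -> integrableT (fun w => h w * g t w).
Proof.
move=> t0; apply: integrable_le (integrableDr (integrable_h2g t0) (integrable_g t0)).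
  exact: measurable_funM.
move=> w; rewrite normrM (gtr0_norm (g_gt0 _ _)) -[X in _ + X]mul1r -mulrDl.
rewrite ler_wpM2r ?(ltW (g_gt0 _ _))//.
by rewrite -real_normK ?num_real//; have := normr_ge0 (h w); nra.
Qed.

Let integrable_hYg t : 0 < t -> integrableT (fun w => h w * Y w * g t w).
Proof.
move=> t0; apply: integrable_le (integrableDr (integrable_h2g t0) (integrable_Y2g t0)).
  by apply: measurable_funM => //; exact: measurable_funM.
move=> w; rewrite normrM (gtr0_norm (g_gt0 _ _)) -mulrDl normrM (ger0_norm (Y_ge0 w)).
rewrite ler_wpM2r ?(ltW (g_gt0 _ _))//.
by rewrite -[h w ^+ 2]real_normK ?num_real//; nra.
Qed.

Let J t := \int[mu]_w (h w * g t w).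
Let K t := \int[mu]_w (h w * Y w * g t w).
Let Q t := \int[mu]_w (h w ^+ 2 * g t w).

Let is_derive_hg w (t : R) :
  is_derive t 1 (fun s => h w * g s w) (- (h w * Y w * g t w)).
Proof.
rewrite /g; apply: is_derive_eq.
by rewrite /GRing.scale/=; ring.
Qed.

(** Differentiation under the integral on []t / 2, 2 * t[]. As [Y >= 0], [g] decreases in its
    parameter, so its value at [t / 2] gives the dominating function. *)
Let J_derive (t : R) : 0 < t -> is_derive t 1 J (- K t).
Proof.
move=> t0; have t20 : 0 < t / 2 by rewrite divr_gt0.
pose f s w := h w * g s w.
have d1E s w : partial1of2 f s w = - (h w * Y w * g s w).
  by rewrite /partial1of2 derive1E; have [] := is_derive_hg w s.
have tI : `]t / 2, 2 * t[%classic t by rewrite /= in_itv/=; apply/andP; split; lra.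
have fI s : `]t / 2, 2 * t[%classic s -> integrableT (f s).
  rewrite /= in_itv/= => /andP[ts _]; apply: integrable_hg; exact: lt_trans ts.
have fD s w : `]t / 2, 2 * t[%classic s -> [set: Omega] w -> derivable (f^~ w) s 1.
  by move=> _ _; have [] := is_derive_hg w s.
pose G w := `|h w * Y w * g (t / 2) w|.
have G0 w : 0 <= G w by exact: normr_ge0.
have GI : integrableT G.
  by apply: integrable_norm; exact: integrable_hYg.
have fG s w : `]t / 2, 2 * t[%classic s -> [set: Omega] w -> `|partial1of2 f s w| <= G w.
  rewrite /= in_itv/= => /andP[/ltW ts _] _; rewrite d1E normrN /G !normrM.
  rewrite ler_wpM2l ?mulr_ge0//.
  by rewrite !gtr0_norm ?g_gt0//; exact: g_le.
apply: DeriveDef.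
  exact: (derivable_under_integral measurableT tI fI fD G0 GI fG).
rewrite -derive1E (differentiation_under_integral measurableT tI fI fD G0 GI fG).
under eq_Rintegral do rewrite d1E -mulN1r.
by rewrite RintegralZl// ?mulN1r//; exact: integrable_hYg.
Qed.

Let Q_ge0 t : 0 <= Q t.
Proof.
by apply: Rintegral_ge0 => w _; exact: sqr_g_ge0.
Qed.

(* Cauchy-Schwarz, from the nonnegativity of the integral of (h - c)^2 g at
   the minimizing constant c. *)
Let J_sqr t : 0 < t -> J t ^+ 2 * t ^+ k <= Q t.
Proof.
move=> t0; pose c := J t * t ^+ k.
have ig := integrable_g t0; have ihg := integrable_hg t0.
have ih2g := integrable_h2g t0.
have : 0 <= \int[mu]_w (h w ^+ 2 * g t w + ((- 2 * c) * (h w * g t w) + c ^+ 2 * g t w)).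
  apply: Rintegral_ge0 => w _.
  rewrite (_ : _ + _ = (h w - c) ^+ 2 * g t w); last by ring.
  exact: sqr_g_ge0.
rewrite RintegralD//; last by apply: integrableDr; exact: integrableZr.
rewrite RintegralD//; try exact: integrableZr.
rewrite !RintegralZl// Rintegral_g// -/(J t) -/(Q t).
rewrite (_ : - 2 * c * J t + c ^+ 2 * t ^- k = - (J t ^+ 2 * t ^+ k)) ?subr_ge0//.
by rewrite /c; field; rewrite expf_neq0// gt_eqF.
Qed.

Let J_bounded t : 1 <= t -> `|J t| <= \int[mu]_w `|h w * g 1 w|.
Proof.
move=> t1; have t0 : 0 < t by exact: lt_le_trans t1.
apply: le_trans (le_normr_Rintegral measurableT (integrable_hg t0)) _.
apply: le_Rintegral => //.
- by apply: integrable_norm; exact: integrable_hg.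
- by apply: integrable_norm; exact: integrable_hg.
- move=> w _; rewrite !normrM ler_wpM2l// !gtr0_norm ?g_gt0//; exact: g_le.
Qed.

(** Expanding the square, the difference of the two sides of [dominated] is $t^2 Q + 2 t^2 m K +
    2t(td - 1) J$, which is at most 0; it remains to divide by [t]. *)
Let Q_le t : 0 < t -> t * Q t <= 2 * ((1 - d * t) * J t - m * t * K t).
Proof.
move=> t0.
have ihg := integrable_hg t0; have ih2g := integrable_h2g t0.
have ihYg := integrable_hYg t0; have il := integrable_linear_loss t0.
have : \int[mu]_w ((t * (m * Y w + d + h w) - 1) ^+ 2 * g t w) <=
       \int[mu]_w ((t * (m * Y w + d) - 1) ^+ 2 * g t w).
  apply: fine_le; [| |exact: dominated].
  - by apply: integrable_fin_num => //; exact: integrable_loss.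
  - exact: integrable_fin_num.
rewrite (@eq_Rintegral _ _ _ _ _ (fun w => (t * (m * Y w + d) - 1) ^+ 2 * g t w +
  (t ^+ 2 * (h w ^+ 2 * g t w) + (2 * t ^+ 2 * m * (h w * Y w * g t w) +
   2 * t * (t * d - 1) * (h w * g t w))))); last by move=> w _; ring.
rewrite RintegralD//; last first.
  by do ?apply: integrableDr; exact: integrableZr.
rewrite gerDl RintegralD//; [|exact: integrableZr|]; last first.
  by do ?apply: integrableDr; exact: integrableZr.
rewrite RintegralD//; try exact: integrableZr.
rewrite !RintegralZl// -/(J t) -/(Q t) -/(K t) => h0.
rewrite -(ler_pM2l t0); lra.
Qed.

(** At a [t] with [Q t <= 0] the nonnegative function [h ^+ 2 * g t] has integral 0, and [g t] is
    positive. *)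
Lemma dominating_estimator_ae : {ae mu, forall w, h w = 0}.
Proof.
have [t t0 Qt] := @differential_inequality R J K Q k m d _ m_ge0 m_le d_gt0
  J_derive (fun t _ => Q_ge0 t) J_sqr J_bounded Q_le.
have ih2g := integrable_h2g t0.
have : (\int[mu]_w `|(h w ^+ 2 * g t w)%:E| = 0)%E.
  under eq_integral do rewrite gee0_abs ?lee_fin ?sqr_g_ge0//.
  rewrite -[LHS]fineK; last exact: integrable_fin_num.
  by congr _%:E; apply/eqP; rewrite eq_le Qt; exact: Q_ge0.
have mh2g : measurable_fun [set: Omega] (fun w => (h w ^+ 2 * g t w)%:E).
  by have /integrableP[] := ih2g.
move=> /(ae_eq_integral_abs mu measurableT mh2g); apply: filterS => w /(_ I) [].
by move/eqP; rewrite mulf_eq0 (gt_eqF (g_gt0 _ _)) orbF sqrf_eq0 => /eqP.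
Qed.

End dominating_estimator.

(** * Admissibility for an exponential family of Gamma type *)

Section gamma_admissibility.
Context (disp : measure_display) (Omega : measurableType disp) (R : realType).
Variables (P : R -> probability Omega R) (Y : Omega -> R) (k : nat).
Hypothesis measurable_Y : measurable_fun [set: Omega] Y.
Hypothesis Y_ge0 : forall w, 0 <= Y w.
Hypothesis tilt : forall (delta : R) (f : R -> \bar R), 0 < delta ->
  measurable_fun [set: R] f -> (forall y, 0 <= f y)%E ->
  (\int[P delta]_w f (Y w) =
   \int[P 1]_w (f (Y w) *
     (delta^-1 ^+ k * expR (- (delta^-1 - 1) * Y w))%:E))%E.

Lemma measurable_loss (est : R -> R) (delta : R) :
  measurable_fun [set: R] est ->
  measurable_fun [set: R] (fun y => (quadratic_loss (est y) delta)%:E).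
Proof.
move=> mest; apply/measurable_EFinP; apply: measurable_funM => //.
by apply: measurable_funX; exact: measurable_funB.
Qed.

Lemma quadratic_loss_ge0 (a delta : R) : 0 <= quadratic_loss a delta.
Proof. by rewrite mulr_ge0 ?sqr_ge0// invr_ge0 sqr_ge0. Qed.

(** At [delta = t^-1] the loss of an estimate [a] is [(t * a - 1) ^+ 2]; [tilt] then moves the
    integral to [P 1]. *)
Lemma risk_tilt (est : R -> R) (t : R) : 0 < t -> measurable_fun [set: R] est ->
  risk P Y est t^-1 = ((t ^+ k)%:E *
    \int[P 1%R]_w ((t * est (Y w) - 1) ^+ 2 * expR (- (t - 1) * Y w))%:E)%E.
Proof.
move=> t0 mest; rewrite /risk unlock.
rewrite (tilt (f := fun y => (quadratic_loss (est y) t^-1)%:E)); last 3 first.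
- by rewrite invr_gt0.
- exact: measurable_loss.
- by move=> y; rewrite lee_fin quadratic_loss_ge0.
rewrite -ge0_integralZl//.
- apply: eq_integral => w _; rewrite invrK /quadratic_loss -!EFinM; congr _%:E.
  by field; rewrite gt_eqF.
- apply/measurable_EFinP; apply: measurable_funM.
    apply: measurable_funX; apply: measurable_funB => //.
    by apply: measurable_funM => //; exact: (measurableT_comp mest).
  by apply: measurableT_comp => //; exact: measurable_funM.
- by move=> w _; rewrite lee_fin mulr_ge0 ?sqr_ge0 ?expR_ge0.
- by rewrite lee_fin exprn_ge0// ltW.
Qed.

(** A competitor at least as good everywhere agrees with the linear estimator [P 1]-almost surely.
    Every risk is an integral against [P 1], so the two risks are equal and no strict improvement is
    possible. *)
Theorem linear_admissible (m d : R) : 0 <= m -> m * k.+1%:R <= 1 -> 0 < d ->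
  admissible P Y (fun r => m * r + d).
Proof.
move=> m0 mk d0.
have mlin : measurable_fun [set: R] (fun r => m * r + d).
  by apply: measurable_funD => //; exact: measurable_funM.
split => // -[est [mest est_le [delta delta0]]].
pose h w := est (Y w) - (m * Y w + d).
have mh : measurable_fun [set: Omega] h.
  apply: measurable_funB; first exact: (measurableT_comp mest).
  exact: (measurableT_comp mlin).
have h0 : {ae P 1, forall w, h w = 0}.
  apply: (dominating_estimator_ae (k := k) measurable_Y mh Y_ge0 m0 mk d0) => t t0.
    have t'0 : 0 < t^-1 by rewrite invr_gt0.
    (* The normalization of the densities is [tilt] for the constant function 1. *)
    have := tilt t'0 (measurable_cst 1%E) (fun=> lee01).
    rewrite integral_cst// mul1e [X in X = _]probability_setT invrK => ->.
    by apply: eq_integral => w _; rewrite mul1e.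
  have := est_le t^-1; rewrite invr_gt0 => /(_ t0).
  rewrite !risk_tilt// lee_pmul2l ?lte_fin ?exprn_gt0//.
  have estE w : est (Y w) = m * Y w + d + h w by rewrite /h; ring.
  by under eq_integral do rewrite estE.
suff -> : risk P Y est delta = risk P Y (fun r => m * r + d) delta by rewrite ltxx.
rewrite -[delta]invrK !risk_tilt ?invr_gt0//; congr (_ * _)%E.
have mr e : measurable_fun [set: R] e -> measurable_fun [set: Omega]
    (fun w => ((delta^-1 * e (Y w) - 1) ^+ 2 * expR (- (delta^-1 - 1) * Y w))%:E).
  move=> me; apply/measurable_EFinP; apply: measurable_funM.
    apply: measurable_funX; apply: measurable_funB => //.
    by apply: measurable_funM => //; exact: (measurableT_comp me).
  by apply: measurableT_comp => //; exact: measurable_funM.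
apply: ae_eq_integral => //; [exact: mr|exact: (mr (fun r => m * r + d))|].
apply: filterS h0 => w hw _; congr (_ %:E); congr ((_ * _ - 1) ^+ 2 * _).
by apply/eqP; rewrite -subr_eq0; apply/eqP.
Qed.

End gamma_admissibility.

Unset Implicit Arguments.

Theorem mainTheorem1 (R : realType) (disp : measure_display)
    (Omega : measurableType disp) (P : R -> probability Omega R)
    (X : nat -> {mfun Omega >-> R}) (n : nat)
    (n_ge2 : (2 <= n)%N)
    (X_iid : forall delta : R, 0 < delta -> iid_exponential (P delta) X delta) :
  let Rn := fun w : Omega => record_range (fun i => X i w) n in
  (forall m d : R, 0 <= m < n%:R^-1 -> 0 < d ->
     admissible P Rn (fun r => m * r + d)) /\
  (forall m d : R, m = n%:R^-1 -> 0 < d ->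
     admissible P Rn (fun r => m * r + d)).
Proof.
move=> Rn; case: n n_ge2 @Rn => [//|k] _ Rn.
have tilt (delta : R) (f : R -> \bar R) : 0 < delta ->
    measurable_fun [set: R] f -> (forall y, 0 <= f y)%E ->
    (\int[P delta]_w f (Rn w) = \int[P 1%R]_w (f (Rn w) *
       (delta^-1 ^+ k * expR (- (delta^-1 - 1) * Rn w))%:E))%E.
  move=> delta0 mf f0; apply: integral_record_range_tilt => //.
  - by rewrite invr_gt0.
  - exact: X_iid.
  - by rewrite invrK; exact: X_iid.
(* Here [n = k.+1], so [k] is the Gamma shape [n - 1]. Both cases of the theorem fall under
   [m <= n%:R^-1]. *)
have adm (m d : R) : 0 <= m -> m <= k.+1%:R^-1 -> 0 < d ->
    admissible P Rn (fun r => m * r + d).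
  move=> m0 mk d0; apply: (linear_admissible (k := k)) => //.
  - exact: measurable_record_range.
  - by move=> w; exact: record_range_ge0.
  - by rewrite -ler_pdivlMr// mul1r.
split=> m d.
  by move=> /andP[m0 mk] d0; apply: adm => //; exact: ltW.
by move=> -> d0; apply: adm => //; rewrite invr_ge0.
Qed.
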